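(* Let $(G,X,x_0)$ be a $0$-dimensional ambit. (1) The following are equivalent: (a) the $G$-ambit $X$ has WDRP; (b) $\mathrm{Inv}(X)\neq\emptyset$. (2) The following are equivalent: (a) the $G$-ambit $X$ has DRP; (b) there exists $\eta\in E(X)$ such that $\eta[Gx_0]\subseteq \mathrm{Inv}(X)$. (3) The following are equivalent: (a) the $G$-ambit $X$ has EDRP; (b) there exists $\eta\in E(X)$ such that $\mathrm{Im}(\eta)\subseteq \mathrm{Inv}(X)$; (c) every minimal subflow of $X$ is trivial (i.e. a singleton).
   Context: Compact spaces are Hausdorff. A flow $(G,X)$ is a topological group $G$ acting continuously on a compact space $X$. An ambit $(G,X,x_0)$ is a flow with a distinguished point $x_0\in X$ whose orbit $Gx_0$ is dense in $X$; it is $0$-dimensional if $X$ is $0$-dimensional (has a basis of clopen sets). $\mathrm{Inv}(X)$ is the set of points of $X$ fixed by all $g\in G$. The Ellis semigroup $E(X)$ is the closure in $X^X$ (product topology) of the set of maps $x\mapsto gx$, $g\in G$, with composition. A coloring is a function $c\colon G\to 2^n$ for some natural number $n\ge 1$. For $S\subseteq X$, $c$ is $S$-definable if there are clopen sets $U_0,\dots,U_{n-1}\subseteq X$ and points $y_0,\dots,y_{n-1}\in S$ such that for all $g\in G$, $i<n$: $c(g)(i)=1$ if $y_i\in gU_i$ and $c(g)(i)=0$ if $y_i\notin gU_i$. The ambit has $S$-DRP if for every $S$-definable coloring $c\colon G\to 2^n$, every $k\ge 1$ and every $A\in[G]^k$ (a $k$-element subset of $G$) there is $h\in G$ such that $|c[hA]|=1$.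 WDRP, DRP, EDRP mean $S$-DRP for $S=\{x_0\}$, $S=Gx_0$, $S=X$, respectively. *)

(* Defs.v *)
From HB Require Import structures.
From mathcomp Require Import all_boot finmap.
From mathcomp Require Import all_classical.
From mathcomp Require Import topology.

Set Implicit Arguments.
Unset Strict Implicit.
Unset Printing Implicit Defensive.

Local Open Scope classical_set_scope.

HB.mixin Record isTopologicalGroup G of Group G & Topological G := {
  mulg_continuous : continuous (fun x : G * G => (x.1 * x.2)%g);
  invg_continuous : continuous (fun x : G => (x^-1)%g)
}.

#[short(type="topologicalGroupType")]
HB.structure Definition TopologicalGroup :=
  {G of Group G & Topological G & isTopologicalGroup G}.

(* The library's [zero_dimensional] only asks that clopen sets separate points;
   here 0-dimensionality is the existence of a basis of clopen sets. *)
Definition has_clopen_basis (X : topologicalType) : Prop :=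
  exists2 B : set (set X), basis B & forall U, B U -> clopen U.

Section Flows.
Context {G : topologicalGroupType} {X : topologicalType}.
Variable act : G -> X -> X.

Definition is_flow : Prop :=
  [/\ compact [set: X],
      hausdorff_space X,
      forall x, act 1%g x = x,
      forall g h x, act (g * h)%g x = act g (act h x)
    & continuous (fun p : G * X => act p.1 p.2)].

Definition orbit_of (x : X) : set X := range (act^~ x).

Definition is_ambit (x0 : X) : Prop := is_flow /\ dense (orbit_of x0).

Definition invariant_points : set X := [set x | forall g, act g x = x].

(* The topology on [{ptws X -> X}] is the product topology on X^X. *)
Definition ellis : set (X -> X) := closure (range act : set {ptws X -> X}).

Definition is_subflow (Y : set X) : Prop :=
  [/\ Y !=set0, closed Y & forall g y, Y y -> Y (act g y)].

Definition is_minimal_subflow (Y : set X) : Prop :=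
  is_subflow Y /\ forall Z, is_subflow Z -> Z `<=` Y -> Z = Y.

Definition definable_coloring (S : set X) (n : nat)
    (c : G -> {ffun 'I_n -> bool}) : Prop :=
  exists (U : 'I_n -> set X) (y : 'I_n -> X),
    [/\ forall i, clopen (U i),
        forall i, S (y i)
      & forall g i, c g i <-> (act g @` U i) (y i)].

Definition has_DRP_on (S : set X) : Prop :=
  forall (n : nat) (c : G -> {ffun 'I_n -> bool}),
    (1 <= n)%N -> definable_coloring S c ->
  forall (k : nat) (A : {fset G}), (1 <= k)%N -> #|` A|%fset = k ->
  exists h : G,
    #|` [fset c b | b in [fset (h * a)%g | a in A]]|%fset = 1%N.

Definition WDRP (x0 : X) : Prop := has_DRP_on [set x0].
Definition DRP (x0 : X) : Prop := has_DRP_on (orbit_of x0).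
Definition EDRP : Prop := has_DRP_on [set: X].

End Flows.

(* Main.v *)
Require Import Defs.
From HB Require Import structures.
From mathcomp Require Import all_boot finmap.
From mathcomp Require Import all_classical.
From mathcomp Require Import topology.

Local Open Scope classical_set_scope.

(** All three equivalences come from one principle ([DRP_ellisP]): for every
    subset [S] of [X], the ambit has [S]-DRP iff some [eta] in the Ellis
    semigroup sends [S] into the set of fixed points.

    A definable coloring records, at [g], whether [g^-1 y_i] lies in [U_i].
    So for a finite set [A] containing [1], saying that the coloring is
    constant on [h A] amounts to saying that the translation by [h^-1] moves
    every [y_i] to a point [x] which [U_i] does not distinguish from [a^-1 x],
    for [a] in [A].
    Thus [S]-DRP says that any finite number of conditions
    [g y] and [a g y] lie on the same side of [U], with [U] clopen, [y] in [S]
    and [a] in [G], can be met by a single [g] ([finitely_invariant]).  These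
    conditions are clopen in the product topology, the Ellis semigroup is
    compact, and [G] is dense in it; hence the conditions are finitely
    satisfiable in [G] iff some [eta] satisfies all of them at once.  As clopen
    sets separate points, that means that [eta y] is fixed by [G] for all [y]
    in [S] ([finitely_invariantP]).

    For [S = {x0}], since the orbit of [x0] is dense, evaluation at [x0] maps
    the Ellis semigroup onto [X], so every fixed point has the form [eta x0]
    ([ellis_onto]).

    For [S = X], an [eta] with fixed values maps a minimal subflow [Y] into
    itself, so [Y] contains a fixed point and collapses to it
    ([fixing_ellis_minimal]).  Conversely, the Ellis semigroup is itself a flow
    and contains a minimal subflow [M]; evaluation at [x] maps [M] onto a minimal
    subflow of [X].  If these are all trivial, every element of [M] has only
    fixed points as values ([minimal_ellis_fixes]). *)

(** * Minimal subflows *)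

(** Zorn's lemma for reverse inclusion on the subflows contained in [K]: by
    compactness, the intersection of a chain of them is nonempty.  The maximal
    element is sought among the sets to remove from [K], so that removing
    nothing covers the empty chain. *)
Lemma exists_minimal_subflow {G : topologicalGroupType} {T : topologicalType}
    (act : G -> T -> T) (K : set T) :
  compact K -> is_subflow act K ->
  exists2 M, is_minimal_subflow act M & M `<=` K.
Proof.
move=> cK sfK; have [_ clK stK] := sfK.
pose P := [set O : set T | is_subflow act (K `\` O)].
have [F FP Ftot|O [PO Omax]] := @Zorn_bigcup _ P.
  have [[O0 FO0]|F0] := pselect (F !=set0); last first.
    rewrite /P /= (_ : _ `\` _ = K) //.
    apply/seteqP; split => [x []//|x Kx]; split => // -[O FO].
    by case: F0; exists O.
  (* A cluster point of the chain lies in all its members. *)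
  have Fproper : ProperFilter (filter_from F (fun O => K `\` O)).
    apply: filter_from_proper; last by move=> O /FP [].
    apply: filter_from_filter; first by exists O0.
    move=> A B FA FB; have [AB|BA] := Ftot A B FA FB.
      by exists B => // x [Kx nBx]; do !split => //; move/AB.
    by exists A => // x [Kx nAx]; do !split => //; move/BA.
  have [|x [Kx clx]] := cK _ Fproper; first by exists O0 => // y [].
  split.
  - exists x; split => // -[O FO Ox]; have [_ clO _] := FP O FO.
    have [] // : (K `\` O) x.
    by apply: clO => B /clx; apply; exists O.
  - rewrite setDE setC_bigcup -bigcapIr; last by exists O0.
    by apply: closed_bigI => O /FP []; rewrite setDE.
  - move=> g y [Ky nFy]; split; first exact: stK.
    move=> [O FO Ogy]; have [_ _ /(_ g y)[|//]] := FP O FO.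
    by split => // Oy; apply: nFy; exists O.
exists (K `\` O); last exact: subDsetl.
split=> // Z sfZ ZKO.
have KZ : K `\` ~` Z = Z.
  by rewrite setDE setCK; apply/setIidPr => z /ZKO[].
have OZ : O `<=` ~` Z by move=> x Ox /ZKO[].
apply/seteqP; split => // x [Kx nOx]; apply: contrapT => nZx.
apply: (Omax (~` Z)); last by rewrite /P /= KZ.
by split => // /(_ x nZx).
Qed.

(** A subflow of the image pulls back to a subflow of [M], hence to [M] itself.
    Compactness of [M] and separation of [X] make the image closed. *)
Lemma image_minimal_subflow {G : topologicalGroupType} {T X : topologicalType}
    (actT : G -> T -> T) (actX : G -> X -> X) (phi : T -> X) (M : set T) :
  hausdorff_space X -> continuous phi ->
  (forall g t, phi (actT g t) = actX g (phi t)) ->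
  compact M -> is_minimal_subflow actT M ->
  is_minimal_subflow actX (phi @` M).
Proof.
move=> hX cphi equi cM [[M0 clM stM] minM].
split; first split.
- by case: M0 => t Mt; exists (phi t); exists t.
- apply: compact_closed => //; apply: continuous_compact => //.
  exact: continuous_subspaceT.
- by move=> g _ [t Mt <-]; rewrite -equi; exists (actT g t) => //; exact: stM.
move=> Z [[z Zz] clZ stZ] ZM; apply/seteqP; split => // _ [t Mt <-].
have MZ : M `&` phi @^-1` Z = M; last by move: Mt; rewrite -{1}MZ => -[].
apply: minM; last exact: subIsetl.
split.
- by have [s Ms sz] := ZM z Zz; exists s; split => //=; rewrite sz.
- by apply: closedI => //; apply: preimage_closed => // ? _; exact: cphi.
- by move=> g s [Ms Zs]; split; [exact: stM|rewrite /= equi; exact: stZ].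
Qed.

(** * The Ellis semigroup as a compact flow *)

Lemma continuous_into_ptws {T : topologicalType} {I : Type} {Y : topologicalType}
    (f : T -> {ptws I -> Y}) :
  (forall i, continuous (f^~ i)) -> continuous f.
Proof.
move=> cf t; apply/cvg_sup => i.
apply: (@continuous_comp_initial _ _ _ (fun h : I -> Y => h i)).
exact: cf.
Qed.

Section Ellis.
Context {G : topologicalGroupType} {X : topologicalType}.
Variable act : G -> X -> X.
Hypothesis flow : is_flow act.

Lemma ptws_eval_continuous (x : X) :
  continuous ((fun f => f x) : {ptws X -> X} -> X).
Proof. exact: (@proj_continuous X (fun=> X) x). Qed.

Lemma act_continuous g : continuous (act g).
Proof.
have [_ _ _ _ cact] := flow; move=> x.
apply: (@continuous_comp _ _ _ (fun x => (g, x)) (fun p => act p.1 p.2)).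
  by apply: cvg_pair; [exact: cvg_cst|exact: cvg_id].
exact: cact.
Qed.

Lemma ellis_compact : compact (ellis act : set {ptws X -> X}).
Proof.
have [cX _ _ _ _] := flow.
apply: (@subclosed_compact _ _ [set: {ptws X -> X}]) => //.
  exact: closed_closure.
have := @tychonoff X (fun=> X) (fun=> setT) (fun=> cX).
by congr (compact _); apply/seteqP.
Qed.

Lemma ellis_sub_closed (C : set {ptws X -> X}) :
  closed C -> (forall g, C (act g)) -> ellis act `<=` C.
Proof.
move=> clC Cact; rewrite /ellis closureE; apply: smallest_sub => //.
by move=> _ [g _ <-].
Qed.

Lemma ellis_closed_eval (C : set X) (x : X) (eta : X -> X) :
  closed C -> (forall g, C (act g x)) -> ellis act eta -> C (eta x).
Proof.
move=> clC Cx; apply: (ellis_sub_closed ((fun f => f x) @^-1` C)) => //.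
by apply: preimage_closed => // ? _; exact: ptws_eval_continuous.
Qed.

(** Stated on [{ptws X -> X}] so that the left translations make this space,
    and not merely the bare function type, carry the structure of
    [is_subflow]. *)
Definition ellis_act (g : G) (f : {ptws X -> X}) : {ptws X -> X} := act g \o f.

(** The closure of the set of translations is stable because left composition
    with [act g] is continuous and permutes the translations. *)
Lemma ellis_subflow : is_subflow ellis_act (ellis act : set {ptws X -> X}).
Proof.
have [_ _ _ actM _] := flow; split.
- by exists (act 1%g); apply: subset_closure; exists 1%g.
- exact: closed_closure.
- move=> g; apply: (ellis_sub_closed (ellis_act g @^-1` ellis act)); last first.
    move=> h; apply: subset_closure; exists (g * h)%g => //.
    by apply/funext => x; rewrite actM.
  apply: preimage_closed; last exact: closed_closure.
  move=> k _; apply: continuous_into_ptws => x {}k.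
  apply: (@continuous_comp {ptws X -> X} X X (fun f => f x)).
    exact: ptws_eval_continuous.
  exact: act_continuous.
Qed.

(** The image of the compact set [ellis act] under evaluation at [x] is closed
    and contains the dense orbit of [x]. *)
Lemma ellis_onto (x p : X) : dense (orbit_of act x) ->
  exists2 eta, ellis act eta & eta x = p.
Proof.
move=> dx; have [_ hX _ _ _] := flow.
pose V := (fun f : {ptws X -> X} => f x) @` (ellis act : set {ptws X -> X}).
have clV : closed V.
  apply: compact_closed => //; apply: continuous_compact ellis_compact.
  by apply: continuous_subspaceT; exact: ptws_eval_continuous.
apply: contrapT => np.
have [||y [nVy [g _ gy]]] := dx (~` V).
- by exists p => -[f Ef fx]; apply: np; exists f.
- by rewrite openC.
by apply: nVy; exists (act g) => //; apply: subset_closure; exists g.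
Qed.

(** * Trivial minimal subflows *)

(** Choosing [eta] in a minimal subflow of the Ellis semigroup works for all
    points [x] simultaneously: the evaluation at each [x] carries that subflow
    onto a minimal subflow of [X] containing [eta x]. *)
Lemma minimal_ellis_fixes :
  (forall Y : set X, is_minimal_subflow act Y -> exists y, Y = [set y]) ->
  exists2 eta, ellis act eta & forall x, invariant_points act (eta x).
Proof.
move=> triv; have [_ hX _ _ _] := flow.
have [M minM ME] := exists_minimal_subflow _ _ ellis_compact ellis_subflow.
have [[[eta Meta] clM _] _] := minM.
have cM := subclosed_compact clM ellis_compact ME.
exists eta => [|x]; first exact: ME.
have minMx := image_minimal_subflow ellis_act act _ _ hX
  (ptws_eval_continuous x) (fun=> fun=> erefl) cM minM.
have [y Mxy] := triv _ minMx.
have ey : eta x = y.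
  have : ((fun f : {ptws X -> X} => f x) @` M) (eta x) by exists eta.
  by rewrite Mxy.
move=> g; rewrite ey; have [[_ _ stMx] _] := minMx.
by move: stMx; rewrite Mxy; apply.
Qed.

(** For [y] in [Y], the point [eta y] lies in [Y] because [Y] is closed and
    stable; being fixed, it is a subflow on its own. *)
Lemma fixing_ellis_minimal (eta : X -> X) (Y : set X) :
  ellis act eta -> (forall x, invariant_points act (eta x)) ->
  is_minimal_subflow act Y -> exists y, Y = [set y].
Proof.
move=> Eeta inv_eta [[[y Yy] clY stY] minY]; have [_ hX _ _ _] := flow.
exists (eta y); apply/esym/minY.
  split; first by exists (eta y).
    exact: accessible_closed_set1 (hausdorff_accessible hX) _.
  by move=> g _ ->; exact: inv_eta.
move=> _ ->; apply: ellis_closed_eval Eeta => // g; exact: stY.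
Qed.

(** * Finitely satisfiable invariance conditions *)

Definition agree (U V : set X) := [set x | U x <-> V x].

Lemma agree_clopen (U V : set X) : clopen U -> clopen V -> clopen (agree U V).
Proof.
move=> cU cV; rewrite (_ : agree U V = (U `&` V) `|` (~` U `&` ~` V)).
  by apply: clopenU; apply: clopenI => //; exact: clopenC.
apply/seteqP; split => x /=; rewrite /agree /=; last by tauto.
by have [] := pselect (U x); tauto.
Qed.

(** If [act a x] differed from [x], a clopen set would separate them. *)
Lemma invariant_pointsP (x : X) : has_clopen_basis X ->
  (forall U a, clopen U -> agree U (act a @^-1` U) x) ->
  invariant_points act x.
Proof.
move=> [B [_ Bnbhs] Bclopen] agr a; have [_ hX _ _ _] := flow.
apply: hX => A C nA nC.
have [U [BU Ux] UC] := Bnbhs _ _ nC.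
exists (act a x); split; first exact: nbhs_singleton.
by apply: UC; apply/(agr U a (Bclopen U BU)).
Qed.

(** A triple [(U, y, a)] stands for the condition on a map [f] that [U] does
    not distinguish [f y] from [act a (f y)]. *)
Definition constraints_on (S : set X) : set (set X * X * G)%type :=
  [set p | clopen p.1.1 /\ S p.1.2].

Definition satisfies (p : (set X * X * G)%type) : set X :=
  agree p.1.1 (act p.2 @^-1` p.1.1).

Lemma satisfies_clopen S p : constraints_on S p -> clopen (satisfies p).
Proof.
move=> [cU _]; apply: agree_clopen => //; apply: preimage_clopen => //.
exact: act_continuous.
Qed.

Definition finitely_invariant (S : set X) : Prop :=
  finI (constraints_on S) (fun p => [set g | satisfies p (act g p.1.2)]).

(** Compactness turns finite satisfiability by translations into one element of
    the Ellis semigroup; conversely, finitely many of the conditions define a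
    neighbourhood of [eta], which contains a translation. *)
Lemma finitely_invariantP (S : set X) : has_clopen_basis X ->
  finitely_invariant S <->
  exists eta, ellis act eta /\ eta @` S `<=` invariant_points act.
Proof.
move=> hdim; split.
- move=> fin; pose F := filter_from (finI_from (constraints_on S)
    (fun p => [set g | satisfies p (act g p.1.2)])) id.
  have pF : ProperFilter F := finI_filter fin.
  have [|eta [Eeta cl_eta]] := @ellis_compact (act @ F) _.
    by apply: (@filterE _ F) => g; apply: subset_closure; exists g.
  exists eta; split => // _ [y Sy <-]; apply: invariant_pointsP => // U a cU.
  have Dp : constraints_on S (U, y, a) by [].
  have clW : closed ((fun f : {ptws X -> X} => f y) @^-1` satisfies (U, y, a)).
    apply: preimage_closed; last by have [] := satisfies_clopen _ _ Dp.
    by move=> ? _; exact: ptws_eval_continuous.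
  apply: clW => B /cl_eta; apply.
  exists [set g | satisfies (U, y, a) (act g y)] => //.
  exact: (finI_from1 (fun p => [set g | satisfies p (act g p.1.2)]) Dp).
- move=> [eta [Eeta inv_eta]] D' D'S.
  pose W (p : (set X * X * G)%type) :=
    (fun f : {ptws X -> X} => f p.1.2) @^-1` satisfies p.
  have : nbhs (eta : {ptws X -> X}) (\bigcap_(p in [set` D']) W p).
    apply: filter_bigI => p pD'; have /set_mem Dp := D'S p pD'.
    apply: ptws_eval_continuous; apply: open_nbhs_nbhs; split.
      by have [] := satisfies_clopen _ _ Dp.
    rewrite /satisfies /agree /= inv_eta //.
    by exists p.1.2 => //; case: Dp.
  by move=> /Eeta[_ [[g _ <-] Wg]]; exists g.
Qed.

(** * Colorings and invariance conditions *)

Lemma translateE (g : G) (U : set X) (y : X) :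
  (act g @` U) y = U (act g^-1%g y).
Proof.
have [_ _ act1 actM _] := flow; apply/propext; split => [[x Ux <-]|Uy].
  by rewrite -actM mulVg act1.
by exists (act g^-1%g y) => //; rewrite -actM mulgV act1.
Qed.

(** The finitely many given conditions are listed to define the coordinates of
    one coloring.  If it is constant on [h A], then [h^-1] satisfies all
    conditions. *)
Lemma DRP_finitely_invariant (S : set X) :
  has_DRP_on act S -> finitely_invariant S.
Proof.
have [_ _ act1 actM _] := flow.
move=> drp D' D'S; have [->|D'0] := eqVneq D' fset0.
  (* A coloring needs at least one coordinate. *)
  by exists 1%g => p /=; rewrite inE.
pose s := enum_fset D'; have sD i : (tnth (in_tuple s) i) \in D'.
  exact: mem_tnth.
pose U i := (tnth (in_tuple s) i).1.1; pose y i := (tnth (in_tuple s) i).1.2.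
pose c (g : G) : {ffun 'I_(size s) -> bool} := [ffun i => `[< (act g @` U i) (y i) >]].
(* The inverses appear because the color of [h * b] looks at the point
   [act b^-1 (act h^-1 y)]; the element [1] supplies the reference color. *)
pose A := (1%g |` [fset (p.2^-1)%g | p in D'])%fset.
have cdef : definable_coloring act S c.
  exists U, y; split.
  - by move=> i; have /set_mem [] := D'S _ (sD i).
  - by move=> i; have /set_mem [] := D'S _ (sD i).
  - by move=> g i; rewrite ffunE; split => /asboolP.
have s0 : (1 <= size s)%N by rewrite lt0n cardfs_eq0.
have A0 : (1 <= #|` A|)%N.
  by rewrite cardfs_gt0; apply/fset0Pn; exists 1%g; rewrite !inE eqxx.
have [h] := drp (size s) c s0 cdef _ A A0 erefl.
move=> /eqP/cardfs1P[v hv].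
have cA a : a \in A -> c (h * a)%g = v.
  move=> aA; apply/fset1P; rewrite -hv; apply/imfsetP => /=.
  by exists (h * a)%g => //; apply: in_imfset.
exists h^-1%g => p pD' /=.
have [i ip] : exists i, p = tnth (in_tuple s) i.
  by apply/tnthP.
have c1 := cA 1%g; have cp := cA (p.2^-1)%g.
have : c h i = c (h * p.2^-1)%g i.
  rewrite cp; last by apply/fset1UP; right; exact: in_imfset.
  by rewrite -[h in LHS]mulg1 c1 // !inE eqxx.
rewrite !ffunE /U /y -ip !translateE invgM invgK actM => e.
by split => /asboolP; [rewrite e|rewrite -e] => /asboolP.
Qed.

(** If [g] meets the conditions [(U_i, y_i, a^-1)], all of [g^-1 A] gets the
    color that records in which [U_i] the points [g y_i] lie. *)
Lemma finitely_invariant_DRP (S : set X) :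
  finitely_invariant S -> has_DRP_on act S.
Proof.
have [_ _ act1 actM _] := flow.
move=> fin n c n0 [U [y [cU Sy cE]]] k A k0 Ak.
pose D' := [fset (U i, y i, a^-1%g) | i in 'I_n, a in A]%fset.
have [p|g satg] := fin D'.
  by move=> /imfset2P[i _ [a aA ->]]; apply/mem_set; split; [exact: cU|exact: Sy].
exists g^-1%g.
have cA a : a \in A -> c (g^-1 * a)%g = [ffun i => `[< U i (act g (y i)) >]].
  move=> aA; apply/ffunP => i; rewrite ffunE.
  have /satg : (U i, y i, a^-1%g) \in D'.
    by apply/imfset2P; exists i => //; exists a.
  rewrite /satisfies /agree /= => sati; apply/idP/asboolP.
    by move=> /cE; rewrite translateE invgM invgK actM => /sati.
  by move=> /sati Ua; apply/cE; rewrite translateE invgM invgK actM.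
apply/eqP/cardfs1P; exists [ffun i => `[< U i (act g (y i)) >]].
apply/fsetP => v; rewrite inE.
apply/imfsetP/eqP => /= [[_ /imfsetP[a /= aA ->] ->]|->].
  exact: cA.
have /fset0Pn[a aA] : A != fset0 by rewrite -cardfs_gt0 Ak.
exists (g^-1 * a)%g; last by rewrite cA.
exact: in_imfset.
Qed.

Lemma DRP_ellisP (S : set X) : has_clopen_basis X ->
  has_DRP_on act S <->
  exists eta, ellis act eta /\ eta @` S `<=` invariant_points act.
Proof.
move=> hdim; rewrite -finitely_invariantP//; split.
  exact: DRP_finitely_invariant.
exact: finitely_invariant_DRP.
Qed.

End Ellis.

Theorem corollary3p6 (G : topologicalGroupType) (X : topologicalType)
    (act : G -> X -> X) (x0 : X)
    (hambit : is_ambit act x0) (hdim : has_clopen_basis X) :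
  (WDRP act x0 <-> invariant_points act !=set0) /\
  (DRP act x0 <->
     exists eta : X -> X,
       ellis act eta /\ eta @` orbit_of act x0 `<=` invariant_points act) /\
  ((EDRP act <->
      exists eta : X -> X, ellis act eta /\ range eta `<=` invariant_points act) /\
   (EDRP act <->
      forall Y : set X, is_minimal_subflow act Y -> exists y : X, Y = [set y])).
Proof.
have [flow dense_x0] := hambit; do !split => //.
- move=> /(DRP_ellisP _ flow _ hdim)[eta [_ inv_eta]].
  by exists (eta x0); apply: inv_eta; exists x0.
- move=> [p inv_p]; apply/(DRP_ellisP _ flow _ hdim).
  have [eta Eeta etap] := ellis_onto _ flow _ p dense_x0.
  by exists eta; split => // _ [_ -> <-]; rewrite etap.
- by move=> /(DRP_ellisP _ flow _ hdim).
- by move=> ?; apply/(DRP_ellisP _ flow _ hdim).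
- by move=> /(DRP_ellisP _ flow _ hdim).
- by move=> ?; apply/(DRP_ellisP _ flow _ hdim).
- move=> /(DRP_ellisP _ flow _ hdim)[eta [Eeta inv_eta]] Y.
  by apply: fixing_ellis_minimal Eeta _ => // x; apply: inv_eta; exists x.
- move=> /(minimal_ellis_fixes _ flow)[eta Eeta inv_eta].
  by apply/(DRP_ellisP _ flow _ hdim); exists eta; split => // _ [x _ <-].
Qed.
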